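(* Assume the mini-batch partitions satisfy $\tilde{\mathbf a}=\tilde{\mathbf b}=\frac1k\mathbf 1_k$. For all $s,t\in\{1,\dots,k\}$ let $\mathbf P^{st}_*\in\mathbf U(\mathbf a^s,\mathbf b^t)$ be an optimal solution of the mini-batch problem $\mathrm{OT}(\alpha^s,\beta^t)=\min_{\mathbf P\in\mathbf U(\mathbf a^s,\mathbf b^t)}\langle \mathbf P,\mathbf C^{st}\rangle$. Let $\omega_{st}$ ($s,t\in\{1,\dots,k\}$) be scalars, let $\mathbf W=(\omega_{st})\in\mathbb R^{k\times k}$, and define $\tilde{\mathbf P}\in\mathbb R^{N\times M}$ block-wise by $$[\tilde{\mathbf P}_{ij}]_{i\in B^s_x,\,j\in B^t_y}=\omega_{st}\,\mathbf P^{st}_*\qquad\text{for all } s,t\in\{1,\dots,k\}.$$ If $\mathbf W\in\mathbf U(\tilde{\mathbf a},\tilde{\mathbf b})$, then $\tilde{\mathbf P}$ is feasible for the full problem $\min_{\mathbf P\in\mathbf U(\mathbf a,\mathbf b)}\langle\mathbf P,\mathbf C\rangle$, that is, $\tilde{\mathbf P}\in\mathbf U(\mathbf a,\mathbf b)$, and its objective value is $$\langle\tilde{\mathbf P},\mathbf C\rangle=\langle\mathbf W,\mathbf D\rangle=\sum_{s,t=1}^k\omega_{st}\,\mathrm{OT}(\alpha^s,\beta^t),$$ where $\mathbf D\in\mathbb R^{k\times k}$ has entries $d_{st}=\mathrm{OT}(\alpha^s,\beta^t)$.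
   Context: Let $X_1,\dots,X_N$ and $Y_1,\dots,Y_M$ be points, $c$ a real-valued cost function, and $\mathbf C\in\mathbb R^{N\times M}$ with $\mathbf C_{ij}=c(X_i,Y_j)$. Let $\mathbf a\in\Delta_N$, $\mathbf b\in\Delta_M$ be probability vectors, $\alpha_N=\sum_i a_i\delta_{X_i}$, $\beta_M=\sum_j b_j\delta_{Y_j}$. For nonnegative vectors $\mathbf p\in\mathbb R^p$, $\mathbf q\in\mathbb R^q$, $\mathbf U(\mathbf p,\mathbf q)=\{\mathbf P\in\mathbb R_+^{p\times q}:\mathbf P\mathbf 1_q=\mathbf p,\ \mathbf P^\top\mathbf 1_p=\mathbf q\}$; $\langle\cdot,\cdot\rangle$ is the Frobenius (entrywise) inner product. $\mathrm{OT}$ denotes (unregularized) discrete optimal transport; e.g. $\mathrm{OT}(\alpha_N,\beta_M)=\min_{\mathbf P\in\mathbf U(\mathbf a,\mathbf b)}\langle\mathbf P,\mathbf C\rangle$. Mini-batches: $N=nk$, $M=mk$ with $n,m,k$ positive integers. The index set $\{1,\dots,N\}$ is partitioned into $k$ (ordered) subsets $B_x^1,\dots,B_x^k$ of size $n$ and $\{1,\dots,M\}$ into $k$ (ordered) subsets $B_y^1,\dots,B_y^k$ of size $m$. $\mathbf C^{st}\in\mathbb R^{n\times m}$ is the submatrix of $\mathbf C$ with rows $B_x^s$ and columns $B_y^t$. The aggregated mini-batch masses are $\tilde{\mathbf a},\tilde{\mathbf b}\in\Delta_k$ with $\tilde{\mathbf a}_s=\sum_{i\in B_x^s}a_i$,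 $\tilde{\mathbf b}_t=\sum_{j\in B_y^t}b_j$. The normalized batch weights are $\mathbf a^s=\frac{1}{\tilde{\mathbf a}_s}(a_i)_{i\in B_x^s}\in\Delta_n$ and $\mathbf b^t=\frac1{\tilde{\mathbf b}_t}(b_j)_{j\in B_y^t}\in\Delta_m$, and $\alpha^s$, $\beta^t$ are the corresponding normalized discrete probability measures on $\{X_i\}_{i\in B_x^s}$ and $\{Y_j\}_{j\in B_y^t}$. *)

(* Defs.v *)
From mathcomp Require Import all_boot all_order all_algebra.
From mathcomp Require Import classical_sets reals.

Set Implicit Arguments.
Unset Strict Implicit.
Unset Printing Implicit Defensive.

Import Order.TTheory GRing.Theory Num.Theory.
Local Open Scope classical_set_scope.
Local Open Scope ring_scope.

Definition simplex (R : realType) (n : nat) : set 'cV[R]_n :=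
  [set a : 'cV[R]_n | (forall i, 0 <= a i 0) /\ \sum_i a i 0 = 1].

Definition transport_plans (R : realType) (n m : nat)
    (p : 'cV[R]_n) (q : 'cV[R]_m) : set 'M[R]_(n, m) :=
  [set P : 'M[R]_(n, m) |
    [/\ forall i j, 0 <= P i j, P *m const_mx 1 = p & P^T *m const_mx 1 = q]].

Definition frobenius (R : realType) (n m : nat) (A B : 'M[R]_(n, m)) : R :=
  \sum_i \sum_j A i j * B i j.

Definition optimal_plan (R : realType) (n m : nat)
    (p : 'cV[R]_n) (q : 'cV[R]_m) (C P : 'M[R]_(n, m)) : Prop :=
  transport_plans p q P /\
  forall Q, transport_plans p q Q -> frobenius P C <= frobenius Q C.

Definition cost_matrix (R : realType) (TX TY : Type) (c : TX -> TY -> R)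
    (n m : nat) (X : 'I_n -> TX) (Y : 'I_m -> TY) : 'M[R]_(n, m) :=
  \matrix_(i, j) c (X i) (Y j).

(* The measure sum_i (weight i) * dirac (atom i); atoms may be repeated. *)
Record discrete_measure (R : realType) (T : Type) (n : nat) :=
  DiscreteMeasure { atom : 'I_n -> T; weight : 'cV[R]_n }.

(* The minimum is taken as an infimum in R, with which it agrees whenever an
   optimal plan exists. *)
Definition OT (R : realType) (TX TY : Type) (c : TX -> TY -> R) (n m : nat)
    (alpha : discrete_measure R TX n) (beta : discrete_measure R TY m) : R :=
  inf [set frobenius P (cost_matrix c (atom alpha) (atom beta))
      | P in transport_plans (weight alpha) (weight beta)].

(* Each batch B s is an ordered n-element subset of 'I_N, given by the list
   of its elements. *)
Definition batch_partition (N n k : nat) (B : 'I_k -> n.-tuple 'I_N) : Prop :=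
  [/\ forall s, uniq (B s),
      forall s s', s != s' -> [disjoint B s & B s']%B &
      forall i, exists s, i \in B s].

Definition aggregated_mass (R : realType) (N n k : nat)
    (B : 'I_k -> n.-tuple 'I_N) (a : 'cV[R]_N) : 'cV[R]_k :=
  \col_s \sum_(i in B s) a i 0.

Definition batch_weight (R : realType) (N n k : nat)
    (B : 'I_k -> n.-tuple 'I_N) (a : 'cV[R]_N) (s : 'I_k) : 'cV[R]_n :=
  (aggregated_mass B a s 0)^-1 *: rowsub (tnth (B s)) a.

Definition batch_measure (R : realType) (T : Type) (N n k : nat)
    (B : 'I_k -> n.-tuple 'I_N) (X : 'I_N -> T) (a : 'cV[R]_N) (s : 'I_k) :
    discrete_measure R T n :=
  DiscreteMeasure (X \o tnth (B s)) (batch_weight B a s).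

Definition block (R : realType) (N M n m k : nat)
    (Bx : 'I_k -> n.-tuple 'I_N) (By : 'I_k -> m.-tuple 'I_M)
    (A : 'M[R]_(N, M)) (s t : 'I_k) : 'M[R]_(n, m) :=
  mxsub (tnth (Bx s)) (tnth (By t)) A.

(* Main.v *)
(* In a row i of the batch s, the block row sums are W s t * (a i / mass s);
   summing over t, the marginal constraint sum_t W s t = mass s cancels the
   normalization and leaves a i.  Columns follow by transposition, and the
   cost is additive over the blocks. *)
Require Import Defs.
From mathcomp Require Import all_boot all_order all_algebra.
From mathcomp Require Import classical_sets reals.
Import Order.TTheory GRing.Theory Num.Theory.
Local Open Scope ring_scope.

Set Implicit Arguments.
Unset Strict Implicit.
Unset Printing Implicit Defensive.

(** Every index occurs exactly once among all the batch positions: [coverB] gives at least one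
    batch, [disjB] at most one, and [uniqB] a single position in it. *)
Lemma sum_batches (V : nmodType) (N n k : nat) (B : 'I_k -> n.-tuple 'I_N)
    (F : 'I_N -> V) :
  batch_partition B -> \sum_i F i = \sum_s \sum_u F (tnth (B s) u).
Proof.
move=> [uniqB disjB coverB].
under [RHS]eq_bigr => s _ do rewrite -(big_tuple _ _ (B s) xpredT F) big_uniq //.
(* After the exchange, [F i] is summed over the batches containing [i]; that range is the single
   batch [s] supplied by coverage. *)
rewrite (exchange_big_dep predT) //=; apply: eq_bigr => i _.
have [s i_s] := coverB i.
rewrite (big_pred1 s) // => s'; apply/idP/eqP => [i_s'|-> //].
by apply/eqP; apply: contraTT i_s => /disjB /disjointFr ->.
Qed.

Lemma frobenius_blocks (R : realType) (N M n m k : nat)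
    (Bx : 'I_k -> n.-tuple 'I_N) (By : 'I_k -> m.-tuple 'I_M)
    (A C : 'M[R]_(N, M)) :
  batch_partition Bx -> batch_partition By ->
  frobenius A C =
    \sum_s \sum_t frobenius (block Bx By A s t) (block Bx By C s t).
Proof.
move=> partx party; rewrite /frobenius (sum_batches _ partx).
apply: eq_bigr => s _; rewrite [RHS]exchange_big; apply: eq_bigr => u _.
rewrite (sum_batches _ party); apply: eq_bigr => t _.
by apply: eq_bigr => v _; rewrite !mxE.
Qed.

Lemma frobeniusZl (R : realType) (n m : nat) (w : R) (A C : 'M[R]_(n, m)) :
  frobenius (w *: A) C = w * frobenius A C.
Proof.
rewrite mulr_sumr; apply: eq_bigr => i _; rewrite mulr_sumr.
by apply: eq_bigr => j _; rewrite mxE mulrA.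
Qed.

Lemma row_sums (R : realType) (n m : nat) (P : 'M[R]_(n, m)) (p : 'cV[R]_n) :
  P *m const_mx 1 = p <-> forall i, \sum_j P i j = p i 0.
Proof.
have rowE i : (P *m const_mx 1) i 0 = \sum_j P i j :> R.
  by rewrite mxE; apply: eq_bigr => j _; rewrite mxE mulr1.
split=> [<- i|sumP]; first by rewrite rowE.
by apply/colP => i; rewrite rowE.
Qed.

(** Only row marginals enter, so that the same lemma applied to transposes also yields the column
    marginals. Nonzero masses make the normalization in [batch_weight] reversible, since [0^-1] is
    [0] by convention. *)
Lemma glued_row_sums (R : realType) (N M n m k : nat)
    (Bx : 'I_k -> n.-tuple 'I_N) (By : 'I_k -> m.-tuple 'I_M)
    (a : 'cV[R]_N) (W : 'M[R]_k) (P : 'I_k -> 'I_k -> 'M[R]_(n, m))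
    (A : 'M[R]_(N, M)) :
  batch_partition Bx -> batch_partition By ->
  (forall s, aggregated_mass Bx a s 0 != 0) ->
  W *m const_mx 1 = aggregated_mass Bx a ->
  (forall s t, P s t *m const_mx 1 = batch_weight Bx a s) ->
  (forall s t, block Bx By A s t = W s t *: P s t) ->
  A *m const_mx 1 = a.
Proof.
move=> [_ _ coverx] party mass_neq0 /row_sums sumW sumP blockA.
apply/row_sums => i; have [s /tnthP[u ->]] := coverx i.
have sum_block t : \sum_v A (tnth (Bx s) u) (tnth (By t) v) =
    W s t * batch_weight Bx a s u 0.
  have /row_sums <- := sumP s t; rewrite mulr_sumr; apply: eq_bigr => v _.
  by have /matrixP/(_ u v) := blockA s t; rewrite !mxE.
rewrite (sum_batches _ party) (eq_bigr _ (fun t _ => sum_block t)) -mulr_suml.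
by rewrite sumW [X in _ * X]mxE mulVKf // mxE.
Qed.

Lemma block_tr (R : realType) (N M n m k : nat)
    (Bx : 'I_k -> n.-tuple 'I_N) (By : 'I_k -> m.-tuple 'I_M)
    (A : 'M[R]_(N, M)) (s t : 'I_k) :
  block By Bx A^T t s = (block Bx By A s t)^T.
Proof. by apply/matrixP => i j; rewrite !mxE. Qed.

Lemma glued_plan (R : realType) (N M n m k : nat)
    (Bx : 'I_k -> n.-tuple 'I_N) (By : 'I_k -> m.-tuple 'I_M)
    (a : 'cV[R]_N) (b : 'cV[R]_M) (W : 'M[R]_k)
    (P : 'I_k -> 'I_k -> 'M[R]_(n, m)) (A : 'M[R]_(N, M)) :
  batch_partition Bx -> batch_partition By ->
  (forall s, aggregated_mass Bx a s 0 != 0) ->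
  (forall t, aggregated_mass By b t 0 != 0) ->
  transport_plans (aggregated_mass Bx a) (aggregated_mass By b) W ->
  (forall s t, transport_plans (batch_weight Bx a s) (batch_weight By b t)
                 (P s t)) ->
  (forall s t, block Bx By A s t = W s t *: P s t) ->
  transport_plans a b A.
Proof.
move=> partx party massx massy [W_ge0 rowW colW] planP blockA; split.
- have [[_ _ coverx] [_ _ covery]] := (partx, party).
  (* Coverage places the entry [(i, j)] in some block, where it is a product of two nonnegative
     numbers. *)
  move=> i j; have [s /tnthP[u ->]] := coverx i.
  have [t /tnthP[v ->]] := covery j; have [P_ge0 _ _] := planP s t.
  have /matrixP/(_ u v) := blockA s t; rewrite !mxE => ->.
  exact: mulr_ge0.
- apply: (glued_row_sums partx party massx rowW _ blockA) => s t.
  by have [] := planP s t.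
(* The blocks of [A^T] are [W^T t s *: PT t s], so the column constraints of [W] and of each [P s t]
   become the row hypotheses, with [Bx] and [By] swapped. *)
- pose PT t s := (P s t)^T.
  apply: (@glued_row_sums _ _ _ _ _ _ By Bx b W^T PT) => // t s.
    by have [] := planP s t.
  by rewrite block_tr blockA linearZ mxE.
Qed.

(** An optimal plan makes the infimum attained: its cost is both a lower bound and a member of the
    set of costs. *)
Lemma OT_optimal (R : realType) (TX TY : Type) (c : TX -> TY -> R) (n m : nat)
    (alpha : discrete_measure R TX n) (beta : discrete_measure R TY m)
    (P : 'M[R]_(n, m)) :
  optimal_plan (weight alpha) (weight beta)
    (cost_matrix c (atom alpha) (atom beta)) P ->
  OT c alpha beta = frobenius P (cost_matrix c (atom alpha) (atom beta)).
Proof.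
set v := frobenius P _; move=> [planP minP]; apply/eqP.
have lb_v : lbound [set frobenius Q (cost_matrix c (atom alpha) (atom beta))
    | Q in transport_plans (weight alpha) (weight beta)]%classic v.
  by move=> _ [Q planQ <-]; exact: minP.
(* [v] shows the set bounded below and [P] shows it nonempty, so [inf] is a genuine infimum and not
   its default value. *)
rewrite eq_le; apply/andP; split; first by apply: ge_inf; [exists v|exists P].
by apply: lb_le_inf => //; exists v, P.
Qed.

Lemma block_cost_matrix (R : realType) (TX TY : Type) (c : TX -> TY -> R)
    (N M n m k : nat) (X : 'I_N -> TX) (Y : 'I_M -> TY)
    (Bx : 'I_k -> n.-tuple 'I_N) (By : 'I_k -> m.-tuple 'I_M) (s t : 'I_k) :
  block Bx By (cost_matrix c X Y) s t =
    cost_matrix c (X \o tnth (Bx s)) (Y \o tnth (By t)).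
Proof. by apply/matrixP => i j; rewrite !mxE. Qed.

Theorem theorem4p1 (R : realType) (TX TY : Type) (c : TX -> TY -> R)
    (N M n m k : nat)
    (n_gt0 : (0 < n)%N) (m_gt0 : (0 < m)%N) (k_gt0 : (0 < k)%N)
    (defN : N = (n * k)%N) (defM : M = (m * k)%N)
    (X : 'I_N -> TX) (Y : 'I_M -> TY)
    (a : 'cV[R]_N) (b : 'cV[R]_M)
    (a_simplex : simplex a) (b_simplex : simplex b)
    (Bx : 'I_k -> n.-tuple 'I_N) (By : 'I_k -> m.-tuple 'I_M)
    (Bx_partition : batch_partition Bx) (By_partition : batch_partition By)
    (a_balanced : aggregated_mass Bx a = k%:R^-1 *: const_mx 1)
    (b_balanced : aggregated_mass By b = k%:R^-1 *: const_mx 1)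
    (Pstar : 'I_k -> 'I_k -> 'M[R]_(n, m))
    (Pstar_optimal : forall s t : 'I_k,
       optimal_plan (batch_weight Bx a s) (batch_weight By b t)
         (block Bx By (cost_matrix c X Y) s t) (Pstar s t))
    (W : 'M[R]_k) (Ptilde : 'M[R]_(N, M))
    (defPtilde : forall s t : 'I_k,
       block Bx By Ptilde s t = W s t *: Pstar s t)
    (W_plan : transport_plans (aggregated_mass Bx a) (aggregated_mass By b) W) :
  let C := cost_matrix c X Y in
  let D : 'M[R]_k := \matrix_(s, t)
    OT c (batch_measure Bx X a s) (batch_measure By Y b t) in
  [/\ transport_plans a b Ptilde,
      frobenius Ptilde C = frobenius W D &
      frobenius W D =
        \sum_(s < k) \sum_(t < k)
          W s t * OT c (batch_measure Bx X a s) (batch_measure By Y b t)].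
Proof.
move=> C D.
have planP s t : transport_plans (batch_weight Bx a s) (batch_weight By b t)
    (Pstar s t) by case: (Pstar_optimal s t).
(* Balanced batches all have mass [1/k], which is nonzero by [k_gt0]. *)
have mass_neq0 (s : 'I_k) : (k%:R^-1 *: const_mx 1 : 'cV[R]_k) s 0 != 0.
  by rewrite !mxE mulr1 invr_eq0 pnatr_eq0 -lt0n.
have defW : frobenius W D = \sum_(s < k) \sum_(t < k)
    W s t * OT c (batch_measure Bx X a s) (batch_measure By Y b t).
  by apply: eq_bigr => s _; apply: eq_bigr => t _; rewrite mxE.
split=> //.
- apply: (glued_plan Bx_partition By_partition _ _ W_plan planP defPtilde).
    by rewrite a_balanced.
  by rewrite b_balanced.
- rewrite defW (frobenius_blocks _ _ Bx_partition By_partition).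
  apply: eq_bigr => s _; apply: eq_bigr => t _.
  (* Once the block of [C] is seen as the cost matrix between batch atoms, optimality of [Pstar s t]
     is, up to conversion, the premise of [OT_optimal] for the two batch measures. *)
  have := Pstar_optimal s t; rewrite defPtilde frobeniusZl block_cost_matrix.
  by move=> optP; congr (_ * _); apply/esym/(OT_optimal (alpha := batch_measure Bx X a s)
    (beta := batch_measure By Y b t) optP).
Qed.
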